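(* Let $(E,\rightarrow)$ be a computation on a finite set $R=\{r_1,\ldots,r_n\}$ of memory regions by a finite set $P$ of processes, with real-time function $\mathit{rt}:E\to T$ and memory content function $m:R\times T\to V$. If all events in $E$ are uniquely modifying, then every snapshot $s:R\to V\times T$ of the computation that is quasi-instantaneously consistent is also causally consistent.
   Context: Model. $P$ is a finite set of processes, $R=\{r_1,\ldots,r_n\}$ a finite set of memory regions, $V$ the set of possible values of a memory region, and $T=\mathbb{N}$ the time domain. $E$ is the set of events. Each event $e\in E$ has a process $e.p\in P$ that performed it and a memory region $e.r\in R$ on which it was performed. The events of each process are sequentially (totally) ordered, and the events on each memory region are sequentially (totally) ordered. Causal order. $\rightarrow$ is the smallest transitive relation on $E$ such that $e\rightarrow f$ whenever $e.p=f.p$ and $e$ immediately precedes $f$ in the sequential order of that process, and $e\rightarrow f$ whenever $e.r=f.r$ and $e$ immediately precedes $f$ in the order of that memory region. Real time. $\mathit{rt}:E\to T$ gives the time at which each event occurred. Ordering the events by $\mathit{rt}$ yields a total order on $E$ extending $\rightarrow$ (that is, $\mathit{rt}$ is injective and $e\rightarrow f$ implies $\mathit{rt}(e)<\mathit{rt}(f)$). Memory contents. $m(r,t)$ is the value of region $r$ at time $t$ (ground truth). Value changes are effects of events: for a region $r$ and time $t$, let $\mathit{event}(r,t)$ be the most recent event $e$ on $r$ with $\mathit{rt}(e)\le t$ (if one exists). Then $m(r,t)$ is the value $r$ has immediately after $\mathit{event}(r,t)$, or the initial value of $r$ if no event has occurred on $r$ up to time $t$. Uniquely modifying events. An event is uniquely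 modifying if it changes the value of its memory region to a new unique value, i.e. a value different from the initial value of that region and from the values assigned to that region by all other events. Snapshots. A snapshot is a function $s:R\to V\times T$, written $s(r)=(s(r).v,\,s(r).t)$, where $s(r).t$ is the time at which region $r$ was copied and $s(r).v$ is the value copied from memory at that time, i.e. $s(r).v=m(r,s(r).t)$. Cut of a snapshot. The cut corresponding to $s$ is the set of all events $e\in E$ such that, with $r=e.r$, the event $e$ equals $\mathit{event}(r,s(r).t)$ or precedes it in the order of region $r$ (so it contains no event on $r$ if $\mathit{event}(r,s(r).t)$ does not exist). Causal consistency. A set $c\subseteq E$ is a consistent cut if for all $e\in c$ and $e'\in E$, $e'\rightarrow e$ implies $e'\in c$. A snapshot is causally consistent if its corresponding cut is a consistent cut. Quasi-instantaneous consistency. A snapshot $s$ is instantaneous if $s(r).t=s(r').t$ for all $r,r'\in R$. A snapshot $s$ is quasi-instantaneously consistent if there exists an instantaneous snapshot $s'$ (of the same computation) such that $s'(r).v=s(r).v$ for all $r\in R$. *)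

(* Defs.v *)
From Stdlib Require Import Relation_Operators.
From mathcomp Require Import all_boot.
From mathcomp Require Import boolp classical_sets functions cardinality.

Set Implicit Arguments.
Unset Strict Implicit.
Unset Printing Implicit Defensive.

Local Open Scope classical_set_scope.

(* The last clause says that A is enumerated by lt as a finite or infinite
   sequence e_1, e_2, ...; without it, distinct elements of A need not be
   linked by a chain of immediate predecessors. *)
Definition sequential_order (E : Type) (A : set E) (lt : E -> E -> Prop) : Prop :=
  [/\ forall e, A e -> ~ lt e e,
      forall e f g, A e -> A f -> A g -> lt e f -> lt f g -> lt e g,
      forall e f, A e -> A f -> e <> f -> lt e f \/ lt f e
    & forall f, A f -> finite_set [set e | A e /\ lt e f]].

Definition immediately_precedes (E : Type) (A : set E) (lt : E -> E -> Prop)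
    (e f : E) : Prop :=
  [/\ A e, A f, lt e f & ~ exists g, [/\ A g, lt e g & lt g f]].

Record computation (P R : finType) (E : Type) := Computation {
  proc : E -> P;
  region : E -> R;
  proc_lt : P -> E -> E -> Prop;
  region_lt : R -> E -> E -> Prop;
  proc_ltP : forall p, sequential_order [set e | proc e = p] (proc_lt p);
  region_ltP : forall r, sequential_order [set e | region e = r] (region_lt r)
}.

Section Model.
Variables (P R : finType) (V E : Type) (C : computation P R E).

Definition causal_step (e f : E) : Prop :=
  (exists p, immediately_precedes [set x | proc C x = p] (proc_lt C p) e f) \/
  (exists r, immediately_precedes [set x | region C x = r] (region_lt C r) e f).

Definition causal : E -> E -> Prop := clos_trans E causal_step.

Definition real_time (rt : E -> nat) : Prop :=
  injective rt /\ forall e f, causal e f -> rt e < rt f.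

Variable rt : E -> nat.

Definition most_recent (r : R) (t : nat) (e : E) : Prop :=
  [/\ region C e = r, rt e <= t
    & forall f, region C f = r -> rt f <= t -> rt f <= rt e].

Definition event (r : R) (t : nat) : option E :=
  if pselect (exists e, most_recent r t e) is left ex_e
  then Some (sval (cid ex_e)) else None.

(* init r is the initial value of r, and after e the value that the region
   of e has immediately after e. *)
Variables (init : R -> V) (after : E -> V).

Definition memory_content (m : R -> nat -> V) : Prop :=
  forall r t, m r t = if event r t is Some e then after e else init r.

Definition uniquely_modifying (e : E) : Prop :=
  after e <> init (region C e) /\
  forall f, region C f = region C e -> f <> e -> after e <> after f.

Definition cut (s : R -> V * nat) : set E :=
  [set e | exists2 f, event (region C e) (s (region C e)).2 = Some f
                    & e = f \/ region_lt C (region C e) e f].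

Definition consistent_cut (c : set E) : Prop :=
  forall e e', c e -> causal e' e -> c e'.

Definition causally_consistent (s : R -> V * nat) : Prop :=
  consistent_cut (cut s).

Variable m : R -> nat -> V.

Definition snapshot (s : R -> V * nat) : Prop :=
  forall r, (s r).1 = m r (s r).2.

Definition instantaneous (s : R -> V * nat) : Prop :=
  forall r r', (s r).2 = (s r').2.

Definition quasi_instantaneous (s : R -> V * nat) : Prop :=
  exists s', [/\ snapshot s', instantaneous s' & forall r, (s' r).1 = (s r).1].

End Model.

(* Main.v *)
(* Unique values let one recover event(r, t) from m(r, t), so s and the
   instantaneous snapshot s' with the same values have the same cut. A cut
   consists of the events e with rt e <= s(e.r).t; for s' this is a sublevel
   set of rt, which is closed under causal predecessors. *)
Require Import Defs.
From Stdlib Require Import Relation_Operators.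
From mathcomp Require Import all_boot.
From mathcomp Require Import boolp classical_sets cardinality.

Set Implicit Arguments.
Unset Strict Implicit.
Unset Printing Implicit Defensive.

Lemma lt_clos_trans_immediately_precedes (E : eqType) (A : set E)
    (lt : E -> E -> Prop) (e f : E) :
  sequential_order A lt -> A e -> A f -> lt e f ->
  clos_trans E (immediately_precedes A lt) e f.
Proof.
move=> [lt_irr lt_trans _ fin] Ae Af ef.
have [s sE] : exists s : seq E, forall g, A g -> lt e g -> lt g f -> g \in s.
  have [s sE] := (finite_seqP _).1 (fin f Af).
  by exists s => g Ag _ gf; have : [set` s]%classic g by rewrite -sE.
elim: s e f Ae Af ef sE {fin} => [|x s IH] e f Ae Af ef sE.
  by apply: t_step; split=> // -[g [Ag eg gf]]; have := sE g Ag eg gf.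
have [[Ax ex xf]|nx] := pselect [/\ A x, lt e x & lt x f].
  (* By irreflexivity [x] lies in neither half, so the tail of the list covers both. *)
  apply: (t_trans _ _ _ x); apply: IH => // g Ag.
    move=> eg gx; have := sE g Ag eg (lt_trans _ _ _ Ag Ax Af gx xf).
    by rewrite inE => /orP[/eqP gE|//]; case: (lt_irr x Ax); rewrite -{1}gE.
  move=> xg gf; have := sE g Ag (lt_trans _ _ _ Ae Ax Ag ex xg) gf.
  by rewrite inE => /orP[/eqP gE|//]; case: (lt_irr x Ax); rewrite -{2}gE.
apply: IH => // g Ag eg gf; have := sE g Ag eg gf.
by rewrite inE => /orP[/eqP gE|//]; case: nx; rewrite -gE.
Qed.

Section Cuts.
Variables (P R : finType) (V E : Type) (C : computation P R E) (rt : E -> nat).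

(** Causality is generated by immediate precedence alone; finiteness of initial segments yields the
    whole region order. *)
Lemma region_lt_causal (e f : E) :
  region C e = region C f -> region_lt C (region C f) e f -> causal C e f.
Proof.
move=> ef ltef.
(* [{classic E}] equips [E] with the equality test that list membership requires. *)
have := @lt_clos_trans_immediately_precedes {classic E} _ _ e f
          (region_ltP C (region C f)) ef erefl ltef.
elim=> [x y xy|x y z _ xy _ yz]; last exact: t_trans xy yz.
by apply: t_step; right; exists (region C f).
Qed.

Lemma event_most_recent (r : R) (t : nat) (e : E) :
  event C rt r t = Some e -> most_recent C rt r t e.
Proof. by rewrite /event; case: pselect => // p [<-]; exact: svalP (cid p). Qed.

Lemma event_exists (t : nat) (e : E) :
  rt e <= t -> exists f, event C rt (region C e) t = Some f.
Proof.
move=> et; rewrite /event; case: pselect => [p|nex]; first by eexists.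
(* The times of events on the region up to [t] are bounded by [t] and include [rt e], so there is a
   largest one. *)
pose Q n := `[< exists f, [/\ region C f = region C e, rt f <= t & rt f = n] >].
have exQ : exists n, Q n by exists (rt e); apply/asboolP; exists e.
have Qt n : Q n -> n <= t by move=> /asboolP[f [_ ft <-]].
case: (ex_maxnP exQ Qt) => _ /asboolP[f [fe ft <-]] fmax.
case: nex; exists f; split=> // g ge gt.
by apply: fmax; apply/asboolP; exists g.
Qed.

(** Within a region, order and real time agree. Conversely, an [e] placed after the most recent
    event [f] would have a later time than [f], against the maximality of [f]. *)
Lemma cutP (s : R -> V * nat) (e : E) :
  real_time C rt -> cut C rt s e <-> rt e <= (s (region C e)).2.
Proof.
move=> [_ rt_causal]; split=> [[f /event_most_recent[fe ft _]]|et].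
  move=> [->|ltef]; first by rewrite fe.
  apply: leq_trans ft; apply/ltnW/rt_causal.
  by apply: region_lt_causal; rewrite fe.
have [f ef] := event_exists et; exists f => //.
have [fe _ fmax] := event_most_recent ef.
have [->|ne] := pselect (e = f); [by left|right].
have [_ _ total _] := region_ltP C (region C e).
case: (total e f erefl fe ne) => // ltfe.
have := rt_causal _ _ (region_lt_causal fe ltfe).
by rewrite ltnNge fmax.
Qed.

Variables (init : R -> V) (after : E -> V) (m : R -> nat -> V).

(** Distinct events on [r] leave distinct values, and none leaves the initial value, which rules out
    the mixed cases. *)
Lemma event_eq_of_memory_eq (r : R) (t t' : nat) :
  memory_content C rt init after m ->
  (forall e, uniquely_modifying C init after e) ->
  m r t = m r t' -> event C rt r t = event C rt r t'.
Proof.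
move=> mE um; rewrite !mE.
case et: (event C rt r t) => [e|]; case et': (event C rt r t') => [f|] //.
- have [er _ _] := event_most_recent et.
  have [fr _ _] := event_most_recent et'.
  move=> ef; have [->//|nfe] := pselect (f = e).
  by have [_ /(_ f _ nfe)] := um e; rewrite er fr => /(_ erefl).
- have [er _ _] := event_most_recent et.
  by move=> ei; have [] := um e; rewrite er.
- have [fr _ _] := event_most_recent et'.
  by move=> /esym fi; have [] := um f; rewrite fr.
Qed.

End Cuts.

Theorem proposition1 (P R : finType) (V E : Type) (C : computation P R E)
    (rt : E -> nat) (init : R -> V) (after : E -> V) (m : R -> nat -> V) :
  real_time C rt ->
  memory_content C rt init after m ->
  (forall e : E, uniquely_modifying C init after e) ->
  forall s : R -> V * nat,
    snapshot m s -> quasi_instantaneous m s -> causally_consistent C rt s.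
Proof.
move=> rtP mE um s ms [s' [ms' inst ss']].
have cutE e : cut C rt s e <-> cut C rt s' e.
  rewrite /cut /= (@event_eq_of_memory_eq _ _ _ _ _ _ _ _ _ _ _
    (s' (region C e)).2 mE um) //.
  by rewrite -ms -ms' ss'.
move=> e e' /cutE/(cutP _ _ rtP) et e'e; apply/cutE/(cutP _ _ rtP).
(* The regions of [e'] and [e] may differ, but [s'] copies both at the same time. *)
rewrite (inst _ (region C e)); apply: (leq_trans _ et).
by apply: ltnW; apply: rtP.2.
Qed.
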